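(* Let $f:Y\to X$ be a proper map of generalized continua. Then: (i) there exists an $f$-efficient compact exhaustion $\{K_i\}$ of $X$; and (ii) if, furthermore, $f$ is injective, then $f$ is an embedding and $\{f^{-1}(K_i)\}$ is an efficient compact exhaustion of $Y$.
   Context: Spaces are Hausdorff; maps are continuous; a map is proper if preimages of compacta are compact. A generalized continuum is a Hausdorff space that is connected, locally connected, $\sigma$-compact, and locally compact. Connected implies nonempty. A subset of a space $X$ is bounded if its closure in $X$ is compact, and unbounded otherwise. A compact exhaustion of a space $X$ is a sequence $K_1\subseteq K_2\subseteq\cdots$ (indexed by $i\in\mathbb{Z}_+$) of compact subspaces of $X$ with $X=\bigcup_iK_i$ and $K_i\subseteq\mathrm{Int}_X K_{i+1}$ for each $i$. A compactum $K\subseteq X$ is efficient (in $X$) if $K$ is connected (hence nonempty) and every component of $X-K$ is unbounded in $X$. A compact exhaustion is efficient if each $K_i$ is efficient. For a map $f:Y\to X$, a compact exhaustion $\{K_i\}$ of $X$ is $f$-efficient if: $\{K_i\}$ is an efficient compact exhaustion of $X$; $\{\operatorname{Im}f\cap K_i\}$ is an efficient compact exhaustion of $\operatorname{Im}f$; and $\{f^{-1}(K_i)\}$ is a compact exhaustion of $Y$. *)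

(* Defs.v *)
From mathcomp Require Import all_boot all_order all_algebra.
From mathcomp Require Import all_classical topology.

Set Implicit Arguments.
Unset Strict Implicit.
Unset Printing Implicit Defensive.

Local Open Scope classical_set_scope.

Section Spaces.
Context {X : topologicalType}.

(* The library's [connected] holds of [set0]; here connectedness of a space or
   of a subset always includes nonemptiness. *)
Definition nonempty_connected (A : set X) : Prop := A !=set0 /\ connected A.

Definition bounded_in (A : set X) : Prop := compact (closure A).

Definition component_of (A C : set X) : Prop :=
  exists2 x, A x & C = connected_component A x.

(* Exhaustions are indexed by [nat], so [K 0] is the paper's $K_1$. *)
Definition compact_exhaustion (K : nat -> set X) : Prop :=
  [/\ forall i, compact (K i),
      forall i, K i `<=` K i.+1,
      \bigcup_i K i = [set: X]
    & forall i, K i `<=` interior (K i.+1)].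

Definition efficient (K : set X) : Prop :=
  [/\ compact K,
      nonempty_connected K
    & forall C, component_of (~` K) C -> ~ bounded_in C].

Definition efficient_compact_exhaustion (K : nat -> set X) : Prop :=
  compact_exhaustion K /\ forall i, efficient (K i).

End Spaces.

Definition locally_connected_space (X : topologicalType) : Prop :=
  forall (x : X) (U : set X), nbhs x U ->
    exists V : set X, [/\ open V, V x, connected V & V `<=` U].

Definition sigma_compact_space (X : topologicalType) : Prop :=
  exists2 K : nat -> set X,
    forall i, compact (K i) & \bigcup_i K i = [set: X].

Definition generalized_continuum (X : topologicalType) : Prop :=
  [/\ hausdorff_space X,
      nonempty_connected [set: X],
      locally_connected_space X,
      sigma_compact_space X
    & locally_compact [set: X]].

Section Maps.
Context {Y X : topologicalType}.

Definition proper_map (f : Y -> X) : Prop :=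
  continuous f /\ forall K : set X, compact K -> compact (f @^-1` K).

Definition homeomorphism (h : Y -> X) : Prop :=
  continuous h /\
  exists g : X -> Y, [/\ cancel h g, cancel g h & continuous g].

End Maps.

Section Image.
Context {Y X : topologicalType}.
Implicit Types f : Y -> X.

(* [set_type (range f)] carries the subspace topology induced from [X]. *)
Definition image_space f : topologicalType := set_type (range f).

Definition onto_image f (y : Y) : image_space f :=
  exist _ (f y) (mem_set (imageT f y)).

Definition embedding f : Prop := homeomorphism (onto_image f).

(* $\{\operatorname{Im} f\cap K_i\}$ is a sequence of subsets of the space
   $\operatorname{Im} f$; in [image_space f], [Im f `&` K i] is the preimage of
   [K i] under the inclusion [set_val]. *)
Definition f_efficient f (K : nat -> set X) : Prop :=
  [/\ efficient_compact_exhaustion K,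
      @efficient_compact_exhaustion (image_space f)
        (fun i => set_val @^-1` K i)
    & compact_exhaustion (fun i => f @^-1` K i)].

End Image.

(* Main.v *)
(* In a generalized continuum every compactum lies in a compact connected set,
   and adding to the latter the bounded components of its complement makes it
   efficient.  The image [Z] of [f] is again a generalized continuum, [f] being
   a closed map onto [Z].  Given a compactum of [X], take a compact connected
   [M] containing it and meeting [Z], then [A] efficient in [Z] containing the
   trace of [M], and fill in the bounded components of the complement of
   [M `|` A]; the result is efficient in [X] and its trace on [Z] is still [A].
   Iterating gives (i); (ii) transports efficiency from [Z] to [Y]. *)
Require Import Defs.
From mathcomp Require Import all_boot all_order all_algebra.
From mathcomp Require Import all_classical topology.

Local Open Scope classical_set_scope.

(** * Compactness, boundedness and components *)

(** If [P A] failed, the sets [B] with [P] true of the part of [A] outside [B] would form a proper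
    filter containing [A]; a neighbourhood [U] with [P U] of a cluster point in [A] would have its
    complement in that filter, which is absurd. *)
Lemma compact_set_ind {T : topologicalType} (P : set T -> Prop) (A : set T) :
    P set0 -> (forall B C, B `<=` C -> P C -> P B) ->
    (forall B C, P B -> P C -> P (B `|` C)) ->
    compact A -> (forall x, A x -> exists2 U, nbhs x U & P U) ->
  P A.
Proof.
move=> P0 Psub PU cA Ploc; apply: contrapT => nPA.
pose F : set_system T := [set B | P (A `\` B)].
have FF : ProperFilter F.
  split; first by rewrite /F/= setD0.
  split; rewrite /F/=.
  - by rewrite setDT.
  - by move=> B C PB PC; rewrite /= setDIr; exact: PU.
  - by move=> B C BC; apply: Psub; exact: setDS.
have FA : F A by rewrite /F/= setDv.
have [x [Ax clx]] := cA F FF FA.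
have [U xU PU'] := Ploc x Ax.
have FCU : F (~` U) by rewrite /F/=; apply: Psub PU'; rewrite setDE setCK; exact: subIsetr.
by have [y []] := clx _ _ FCU xU.
Qed.

Lemma bounded_inS {T : topologicalType} {A B : set T} :
  A `<=` B -> bounded_in B -> bounded_in A.
Proof.
move=> AB cB; apply: (subclosed_compact _ cB); first exact: closed_closure.
exact: closureS.
Qed.

Lemma compact_bounded_in {T : topologicalType} {A : set T} :
  hausdorff_space T -> compact A -> bounded_in A.
Proof.
by move=> hT cA; rewrite /bounded_in -(closure_id _).1 //; exact: compact_closed.
Qed.

Lemma connected_component_unbounded {T : topologicalType} {A : set T} {x} :
  (forall C, component_of A C -> ~ bounded_in C) -> A x ->
  ~ bounded_in (connected_component A x).
Proof. by move=> + Ax; apply; exists x. Qed.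

Lemma connected_component_open {T : topologicalType} (U : set T) x :
  locally_connected_space T -> open U -> open (connected_component U x).
Proof.
move=> lc oU; rewrite openE => y Cy.
have Uy := connected_component_sub Cy.
have [V [oV Vy cV VU]] := lc y U (open_nbhs_nbhs (conj oU Uy)).
rewrite (same_connected_component Cy) /interior/=.
apply: (@filterS _ _ _ V); last exact: open_nbhs_nbhs.
exact: connected_component_max.
Qed.

Lemma closed_open_setT {T : topologicalType} {A : set T} :
  connected [set: T] -> A !=set0 -> open A -> closed A -> A = [set: T].
Proof.
by move=> cT A0 oA cA; apply: cT => //; exists A => //; rewrite setTI.
Qed.

(** * Enlarging compacta in a generalized continuum *)

Lemma generalized_continuum_nbhs {X : topologicalType} (x : X) :
  generalized_continuum X -> exists2 N, nbhs x N & compact N.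
Proof.
case=> _ _ _ _ /(_ x I) [N xN [cN _]]; exists N => //.
by move: xN; rewrite withinET.
Qed.

Lemma compact_subset_interior {X : topologicalType} {A : set X} :
  generalized_continuum X -> compact A -> exists2 N, compact N & A `<=` N°.
Proof.
move=> hX cA; pose P B := exists2 N : set X, compact N & B `<=` N°.
apply: (compact_set_ind P) => //.
- by exists set0 => //; exact: compact0.
- by move=> B C BC [N cN CN]; exists N => //; exact: subset_trans CN.
- move=> B C [M cM BM] [N cN CN]; exists (M `|` N); first exact: compactU.
  by move=> x [/BM|/CN] ?; apply: interiorU; [left|right].
- move=> x _; have [N xN cN] := generalized_continuum_nbhs x hX.
  exists N°; last by exists N.
  exact: nbhs_interior.
Qed.

(* The points joined to [x0] by a compact connected set form a clopen set. *)
Lemma compact_subset_connected {X : topologicalType} (A : set X) (x0 : X) :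
  generalized_continuum X -> compact A ->
  exists K, [/\ compact K, connected K, K x0 & A `<=` K].
Proof.
move=> hX cA; have [hausX [_ cX] lcX _ _] := hX.
pose P B := exists K : set X, [/\ compact K, connected K, K x0 & B `<=` K].
have loc (x : X) : exists V, [/\ open V, V x, connected V & compact (closure V)].
  have [N xN cN] := generalized_continuum_nbhs x hX.
  have [V [oV Vx cV VN]] := lcX x N xN.
  by exists V; split => //; exact: (bounded_inS VN (compact_bounded_in hausX cN)).
(* A compactum joining [x0] to one point of [V] is enlarged by the closure of [V], which is still
   connected and, unlike [V], compact. *)
have join (V : set X) x : V x -> connected V -> compact (closure V) -> P [set x] -> P V.
  move=> Vx cV cclV [K [cK conK Kx0 Kx]]; exists (K `|` closure V); split.
  - exact: compactU.
  - apply: connectedU => //; last exact: connected_closure.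
    by exists x; split; [exact: Kx|exact: subset_closure].
  - by left.
  - by move=> y Vy; right; exact: subset_closure.
have Psub B C : B `<=` C -> P C -> P B.
  by move=> BC [K [? ? ? CK]]; exists K; split => //; exact: subset_trans CK.
have allP : [set x | P [set x]] = [set: X].
  apply: closed_open_setT => //.
  - exists x0; exists [set x0]; split => //; first exact: compact_set1.
    exact: connected1.
  - rewrite openE => x Px; have [V [oV Vx cV cclV]] := loc x.
    apply: (@filterS _ _ _ V); last exact: open_nbhs_nbhs.
    move=> y Vy; apply: (Psub _ V); first by move=> _ ->.
    exact: (join V x).
  - move=> x clx; have [V [oV Vx cV cclV]] := loc x.
    have [y [Py Vy]] := clx V (open_nbhs_nbhs (conj oV Vx)).
    apply: (Psub _ V); first by move=> _ ->.
    exact: (join V y).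
apply: (compact_set_ind P) => //.
- by exists [set x0]; split => //; [exact: compact_set1|exact: connected1].
- move=> B C [K [cK conK Kx BK]] [L [cL conL Lx CL]]; exists (K `|` L); split.
  + exact: compactU.
  + by apply: connectedU => //; exists x0.
  + by left.
  + exact: setUSS.
- move=> x _; have [V [oV Vx cV cclV]] := loc x.
  exists V; first exact: open_nbhs_nbhs.
  apply: (join V x) => //.
  by have : [set: X] x by []; rewrite -allP.
Qed.

(** * Filling in the bounded components of a complement *)

(** A closure point outside [K] has an open component of its own, which must meet that of [x] and so
    coincide with it. *)
Lemma closure_component_setC {X : topologicalType} {K : set X} {x} :
  locally_connected_space X -> closed K ->
  closure (connected_component (~` K) x) `<=` K `|` connected_component (~` K) x.
Proof.
move=> lcX cK y cly; have [Ky|nKy] := pselect (K y); [by left|right].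
have oC : open (connected_component (~` K) y).
  by apply: connected_component_open => //; exact: closed_openC.
have [z [xz yz]] := cly _ (open_nbhs_nbhs (conj oC (connected_component_refl nKy))).
exact: connected_component_trans xz (connected_component_sym yz).
Qed.

(** Otherwise the component would be clopen, hence the whole space, although it misses the points of
    [K]. *)
Lemma closure_component_setC_meets {X : topologicalType} {K : set X} {x} :
    connected [set: X] -> locally_connected_space X -> closed K -> K !=set0 ->
    ~ K x ->
  K `&` closure (connected_component (~` K) x) !=set0.
Proof.
move=> conX lcX cK [k Kk] nKx; apply: contrapT => /nonemptyPn K0.
have clC : closed (connected_component (~` K) x).
  move=> y cly; have [Ky|//] := closure_component_setC lcX cK _ cly.
  by have : set0 y by rewrite -K0.
have CT : connected_component (~` K) x = [set: X].
  apply: closed_open_setT => //.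
  - by exists x; exact: connected_component_refl.
  - by apply: connected_component_open => //; exact: closed_openC.
have : connected_component (~` K) x k by rewrite CT.
by move/connected_component_sub.
Qed.

(* The union of [K] with the bounded components of its complement: on [K]
   itself the component is [set0], which is bounded. *)
Definition fill {X : topologicalType} (K : set X) : set X :=
  [set x | bounded_in (connected_component (~` K) x)].

Lemma sub_fill {X : topologicalType} {K : set X} : K `<=` fill K.
Proof.
move=> x Kx; rewrite /fill/= connected_component_out; last by apply.
by rewrite /bounded_in closure0; exact: compact0.
Qed.

(** Missing the frontier of [N], the component meets [N] in a set that is clopen relative to it;
    this set is nonempty because the closure of the component meets [K], which lies in the interior
    of [N]. *)
Lemma component_setC_sub {X : topologicalType} {K N : set X} {x} :
    connected [set: X] -> locally_connected_space X -> closed K -> K !=set0 ->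
    closed N -> K `<=` N° ->
    connected_component (~` K) x `&` (N `\` N°) = set0 ->
  connected_component (~` K) x `<=` N.
Proof.
move=> conX lcX cK K0 cN KN; have [Kx|nKx] := pselect (K x).
  by rewrite connected_component_out; [move=> _ ? []|exact].
set C := connected_component _ _ => CN0.
have CNE : C `&` N° = C `&` N.
  rewrite eqEsubset; split=> y [Cy Ny]; split=> //; first exact: interior_subset.
  apply: contrapT => nNy; suff : set0 y by [].
  by rewrite -CN0.
have <- : C `&` N = C.
  apply: (component_connected (A := ~` K)).
  - have [k [Kk clk]] := closure_component_setC_meets conX lcX cK K0 nKx.
    have [y [Cy Ny]] := clk _ (open_nbhs_nbhs (conj (open_interior N) (KN _ Kk))).
    by exists y; split => //; exact: interior_subset.
  - by exists N°; [exact: open_interior|rewrite CNE].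
  - by exists N.
exact: subIsetr.
Qed.

(** For compactness, take a compact neighbourhood [N] of [K]: the added components that miss its
    frontier lie in [N], and only finitely many meet the frontier, which is compact and covered by
    disjoint open components. *)
Lemma fill_efficient {X : topologicalType} {K : set X} :
  generalized_continuum X -> compact K -> nonempty_connected K ->
  efficient (fill K).
Proof.
move=> hX cptK [K0 conK]; have [hausX [_ conX] lcX _ _] := hX.
have cK := compact_closed hausX cptK.
have oKC : open (~` K) by exact: closed_openC.
have fillE x y : connected_component (~` K) x y -> fill K y = fill K x.
  by rewrite /fill/= => /same_connected_component ->.
have subF x : fill K x -> connected_component (~` K) x `<=` fill K.
  by move=> Fx y Cy; rewrite (fillE _ _ Cy).
have subCF x : ~ fill K x -> connected_component (~` K) x `<=` ~` fill K.
  by move=> nFx y Cy; rewrite /setC/= (fillE _ _ Cy).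
have outK x : ~ fill K x -> ~ K x by move=> + Kx; apply; exact: sub_fill.
split.
- have [N cptN KN] := compact_subset_interior hX cptK.
  have cN := compact_closed hausX cptN.
  (* One compactum [L] must serve for all the bounded components that meet [B]. *)
  pose P B := exists2 L : set X, compact L &
    forall x, fill K x -> B `&` connected_component (~` K) x !=set0 ->
      connected_component (~` K) x `<=` L.
  have [] : P (N `\` N°).
    apply: compact_set_ind.
    + by exists set0; [exact: compact0|move=> x _ [y []]].
    + move=> B C BC [L cL CL]; exists L => // x Fx [y [By Cy]].
      by apply: CL => //; exists y; split => //; exact: BC.
    + move=> B C [L cL BL] [M cM CM]; exists (L `|` M); first exact: compactU.
      move=> x Fx [y [[By|Cy] xy]] z xz.
        by left; apply: (BL x) => //; exists y.
      by right; apply: (CM x) => //; exists y.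
    + rewrite setDE; apply: compact_closedI => //.
      by apply: open_closedC; exact: open_interior.
    + move=> x [Nx nNx].
      have nKx : ~ K x by move=> /KN.
      (* The neighbourhood is the component itself, so no other component meets it; if it is
         unbounded, no bounded one does and [set0] serves. *)
      exists (connected_component (~` K) x).
        apply: open_nbhs_nbhs; split; last exact: connected_component_refl.
        exact: connected_component_open.
      have [Fx|nFx] := pselect (fill K x).
        exists (closure (connected_component (~` K) x)) => // y Fy [z [xz yz]].
        rewrite (same_connected_component yz) -(same_connected_component xz).
        exact: subset_closure.
      exists set0; first exact: compact0.
      by move=> y Fy [z [xz yz]]; case: nFx; rewrite -(fillE _ _ xz) (fillE _ _ yz).
  move=> L cL NL; apply: (subclosed_compact _ (compactU cptN cL)).
    rewrite -[fill K]setCK; apply: open_closedC; rewrite openE => x nFx.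
    rewrite /interior; apply: filterS (subCF _ nFx) _.
    apply: open_nbhs_nbhs; split; first exact: connected_component_open.
    by apply: connected_component_refl; exact: outK.
  move=> x Fx; have [Kx|nKx] := pselect (K x).
    by left; apply: interior_subset; exact: KN.
  have Cx : connected_component (~` K) x x by exact: connected_component_refl.
  have [|/nonemptyPn C0] := pselect ((N `\` N°) `&` connected_component (~` K) x !=set0).
    by move=> /(NL x Fx) CL; right; exact: CL.
  by left; apply: component_setC_sub Cx => //; rewrite setIC.
- have [k Kk] := K0; split; first by exists k; exact: sub_fill.
  (* Each piece is connected and contains [K], since the closure of an added component meets [K]. *)
  have -> : fill K = \bigcup_(x in fill K) (K `|` closure (connected_component (~` K) x)).
    rewrite eqEsubset; split => [x Fx|y [x Fx [Ky|]]].
    + exists x => //; have [Kx|nKx] := pselect (K x); [by left|right].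
      by apply: subset_closure; exact: connected_component_refl.
    + exact: sub_fill.
    + by move=> /(closure_component_setC lcX cK _)[/sub_fill//|]; exact: subF.
  apply: bigcup_connected; first by exists k => x _; left.
  move=> x Fx; have [Kx|nKx] := pselect (K x).
    rewrite connected_component_out; last by apply.
    by rewrite closure0 setU0.
  apply: connectedU => //; first exact: closure_component_setC_meets.
  by apply: connected_closure; exact: component_connected.
(* A component of the complement of [fill K] contains an unbounded component of the complement of
   [K]. *)
- move=> _ [x nFx ->] bC; apply: (nFx); apply: bounded_inS bC.
  apply: connected_component_max; last exact: component_connected.
    by apply: connected_component_refl; exact: outK.
  exact: subCF.
Qed.

(** * Compacta efficient both in the target and in the source *)

Lemma component_image_sub {Z X : topologicalType} {i : Z -> X} {A : set Z}
    {B : set X} {z : Z} :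
    continuous i -> A `<=` i @^-1` B -> A z ->
  i @` connected_component A z `<=` connected_component B (i z).
Proof.
move=> ci AB Az; apply: connected_component_max.
- by exists z => //; exact: connected_component_refl.
- by move=> _ [y /connected_component_sub Ay <-]; exact: AB.
- apply: connected_continuous_connected; first exact: component_connected.
  exact: continuous_subspaceT.
Qed.

Lemma bounded_in_proper_preimage {Z X : topologicalType} {i : Z -> X}
    {A : set Z} {B : set X} :
    proper_map i -> hausdorff_space Z -> i @` A `<=` B -> bounded_in B ->
  bounded_in A.
Proof.
move=> [_ pi] hZ iAB bB; apply: bounded_inS (compact_bounded_in hZ (pi _ bB)).
by move=> z Az; apply: subset_closure; apply: iAB; exists z.
Qed.

Lemma exists_efficient {X : topologicalType} {C : set X} :
  generalized_continuum X -> compact C -> exists2 A, efficient A & C `<=` A.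
Proof.
move=> hX cC; have [_ [[x0 _] _] _ _ _] := hX.
have [K [cK conK Kx0 CK]] := compact_subset_connected C x0 hX cC.
exists (fill K); first by apply: fill_efficient => //; split => //; exists x0.
exact: subset_trans sub_fill.
Qed.

(* A component of the complement of [A] in [Z] is unbounded, hence lies in no
   bounded component of the complement of [C `|` i @` A]: filling in those
   components adds no point of [Z]. *)
Lemma exists_biefficient {Z X : topologicalType} {i : Z -> X} {C : set X} :
    generalized_continuum Z -> generalized_continuum X -> proper_map i ->
    injective i -> compact C ->
  exists K, [/\ C `<=` K°, efficient K & efficient (i @^-1` K)].
Proof.
move=> hZ hX pri inji cC; have [ci pi] := pri.
have [hausZ [[z0 _] _] _ _ _] := hZ.
(* Starting from [N] rather than [C] puts [C] in the interior of the final set. *)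
have [N cN CN] := compact_subset_interior hX cC.
have [M [cM conM Mz0 NM]] := compact_subset_connected N (i z0) hX cN.
have [A effA MA] := exists_efficient hZ (pi _ cM).
have [cA [A0 conA] unbA] := effA.
pose B := M `|` i @` A.
have ctsA : {within A, continuous i} by exact: continuous_subspaceT.
have effK : efficient (fill B).
  apply: fill_efficient => //.
    by apply: compactU => //; exact: continuous_compact.
  split; first by exists (i z0); left.
  apply: connectedU => //; last exact: connected_continuous_connected.
  by exists (i z0); split => //; exists z0 => //; exact: MA.
have BA : i @^-1` B = A.
  rewrite eqEsubset; split=> [z [/MA//|[a Aa /inji <-//]]|z Az].
  by right; exists z.
exists (fill B); split => //.
  apply: subset_trans CN _; apply: interiorS => x Nx.
  by apply: sub_fill; left; exact: NM.
suff -> : i @^-1` fill B = A by [].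
rewrite eqEsubset; split=> z; last by rewrite -BA => Bz; exact: sub_fill.
move=> Fz; apply: contrapT => nAz.
have /(connected_component_unbounded unbA) : (~` A) z by [].
apply; apply: bounded_in_proper_preimage Fz => //.
by apply: component_image_sub => //; rewrite -BA.
Qed.

Lemma compact_exhaustion_preimage {Y X : topologicalType} {f : Y -> X}
    {K : nat -> set X} :
  proper_map f -> compact_exhaustion K ->
  compact_exhaustion (fun n => f @^-1` K n).
Proof.
move=> [cf pf] [cK KS KT KI]; split.
- by move=> n; exact: pf.
- by move=> n y; exact: KS.
- by rewrite -preimage_bigcup KT preimage_setT.
- by move=> n y /KI; exact: cf.
Qed.

Lemma exists_biefficient_exhaustion {Z X : topologicalType} {i : Z -> X} :
    generalized_continuum Z -> generalized_continuum X -> proper_map i ->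
    injective i ->
  exists2 K, efficient_compact_exhaustion K &
    efficient_compact_exhaustion (fun n => i @^-1` K n).
Proof.
move=> hZ hX pri inji; have [_ _ _ [L cL LT] _] := hX.
have /choice[G GP] (C : set X) : exists K, compact C ->
    [/\ C `<=` K°, efficient K & efficient (i @^-1` K)].
  (* [set0] is a dummy value that makes [G] total. *)
  have [cC|nC] := pselect (compact C); last by exists set0.
  by have [K] := exists_biefficient hZ hX pri inji cC; exists K.
(* Engulfing [K m] nests the sequence; engulfing [L m] makes it cover the space. Even from [set0],
   [G] yields a nonempty set, as efficiency demands. *)
pose K := fix K n := if n is m.+1 then G (K m `|` L m) else G set0.
have effK n : efficient (K n) /\ efficient (i @^-1` K n).
  elim: n => [|n [[cK _ _] _]]; first by have [] := GP _ compact0.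
  by have [] := GP _ (compactU cK (cL n)).
have KI n : K n `|` L n `<=` (K n.+1)°.
  by have [[cK _ _] _] := effK n; have [] := GP _ (compactU cK (cL n)).
have exhK : compact_exhaustion K.
  split=> [n|n x Kx||n x Kx].
  - by have [[]] := effK n.
  - by apply: interior_subset; apply: KI; left.
  - rewrite eqEsubset; split=> // x _; have : [set: X] x by [].
    rewrite -LT => -[n _ Lx]; exists n.+1 => //.
    by apply: interior_subset; apply: KI; right.
  - by apply: KI; left.
exists K; first by split=> // n; have [] := effK n.
by split=> [|n]; [exact: compact_exhaustion_preimage|have [] := effK n].
Qed.

(** * The image of a proper map as a generalized continuum *)

Section ImageOfProperMap.
Context {Y X : topologicalType}.
Implicit Types f : Y -> X.

Lemma set_val_continuous f : continuous (set_val : image_space f -> X).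
Proof. exact: initial_continuous. Qed.

Lemma onto_image_continuous f : continuous f -> continuous (onto_image f).
Proof. by move=> cf; apply: continuous_comp_initial. Qed.

Lemma onto_image_surj f (z : image_space f) : exists y, onto_image f y = z.
Proof.
by case: z => x xf; have [y _ yx] := set_mem xf; exists y; exact: val_inj.
Qed.

Lemma preimage_set_val f (K : set X) :
  (set_val @^-1` K : set (image_space f)) = onto_image f @` (f @^-1` K).
Proof.
rewrite eqEsubset; split=> [z Kz|_ [y Ky <-] //].
by have [y yz] := onto_image_surj f z; exists y => //; move: Kz; rewrite -yz.
Qed.

Lemma set_val_proper f :
  proper_map f -> proper_map (set_val : image_space f -> X).
Proof.
move=> [cf pf]; split=> [|K cK]; first exact: set_val_continuous.
rewrite preimage_set_val; apply: continuous_compact; last exact: pf.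
by apply: continuous_subspaceT; exact: onto_image_continuous.
Qed.

Lemma image_hausdorff f : hausdorff_space X -> hausdorff_space (image_space f).
Proof.
move=> hX p q pq; apply: val_inj; apply: hX => A B pA qB.
have [z [Az Bz]] := pq _ _ (set_val_continuous f _ _ pA) (set_val_continuous f _ _ qB).
by exists (set_val z).
Qed.

(** Near [z] only the part of [F] lying over a compact neighbourhood [N] matters; that part is
    compact, so its image is closed. *)
Lemma onto_image_closed f (F : set Y) :
    generalized_continuum X -> proper_map f -> closed F ->
  closed (onto_image f @` F).
Proof.
move=> hX [cf pf] cF z clz; have [hausX _ _ _ _] := hX.
have [N zN cN] := generalized_continuum_nbhs (set_val z) hX.
have clFN : closed (onto_image f @` (f @^-1` N `&` F)).
  apply: compact_closed; first exact: image_hausdorff.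
  apply: continuous_compact; last by apply: compact_closedI => //; exact: pf.
  by apply: continuous_subspaceT; exact: onto_image_continuous.
suff : (onto_image f @` (f @^-1` N `&` F)) z by apply: image_subset; exact: subIsetr.
apply: clFN => B zB.
have [_ [[y Fy <-] [By Ny]]] := clz _ (filterI zB (set_val_continuous f _ _ zN)).
by exists (onto_image f y); split=> //; exists y.
Qed.

Lemma image_generalized_continuum f :
    generalized_continuum Y -> generalized_continuum X -> proper_map f ->
  generalized_continuum (image_space f).
Proof.
move=> hY hX pf; have [_ [[y0 _] conY] lcY [L cL LT] _] := hY.
have [hausX _ _ _ _] := hX.
have ch : continuous (onto_image f) by apply: onto_image_continuous; case: pf.
have imT : onto_image f @` [set: Y] = [set: image_space f].
  rewrite eqEsubset; split=> // z _.
  by have [y <-] := onto_image_surj f z; exists y.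
split.
- exact: image_hausdorff.
- split; first by exists (onto_image f y0).
  rewrite -imT; apply: connected_continuous_connected => //.
  exact: continuous_subspaceT.
- move=> z U; rewrite nbhsE => -[V [oV Vz] VU].
  exists (connected_component V z); split.
  (* A closed surjection is a quotient map, so the component is open once its preimage in [Y] is.
     Around a point of that preimage, a connected open [W] mapped into [V] has its image inside the
     same component. *)
  + rewrite -[X in open X]setCK; apply: closed_openC.
    have -> : ~` connected_component V z =
        onto_image f @` (~` (onto_image f @^-1` connected_component V z)).
      rewrite eqEsubset; split=> [w nCw|_ [y nCy <-] //].
      by have [y yw] := onto_image_surj f w; exists y; rewrite /= ?yw.
    apply: onto_image_closed => //; apply: open_closedC; rewrite openE => y Cy.
    have Vy := connected_component_sub Cy.
    have [W [oW Wy conW WV]] := lcY y _ (ch y V (open_nbhs_nbhs (conj oV Vy))).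
    rewrite /interior/=; apply: (@filterS _ _ _ W); last exact: open_nbhs_nbhs.
    move=> w Ww; apply: (connected_component_trans Cy).
    apply: (@connected_component_max _ _ (onto_image f @` W) (onto_image f y)).
    * by exists y.
    * by move=> _ [v /WV Vv <-].
    * apply: connected_continuous_connected => //; exact: continuous_subspaceT.
    * by exists w.
  + exact: connected_component_refl.
  + exact: component_connected.
  + by apply: subset_trans VU; exact: connected_component_sub.
- exists (fun n => onto_image f @` L n) => [n|].
    by apply: continuous_compact => //; exact: continuous_subspaceT.
  by rewrite -image_bigcup LT.
- move=> z _; have [N zN cN] := generalized_continuum_nbhs (set_val z) hX.
  have [cv pv] := set_val_proper f pf.
  exists (set_val @^-1` N); first by rewrite withinET; exact: cv.
  by split; [exact: pv|apply: compact_closed; [exact: image_hausdorff|exact: pv]].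
Qed.

Lemma proper_injective_embedding f :
    generalized_continuum X -> proper_map f -> injective f -> embedding f.
Proof.
move=> hX pf injf.
split; first by apply: onto_image_continuous; case: pf.
have /choice[g gK] := onto_image_surj f.
have hK : cancel (onto_image f) g.
  by move=> y; apply: injf; exact: (congr1 set_val (gK (onto_image f y))).
exists g; split=> //; apply/continuous_closedP => F cF.
have -> : g @^-1` F = onto_image f @` F.
  rewrite eqEsubset; split=> [z Fz|_ [y Fy <-]]; last by rewrite /preimage/= hK.
  by exists (g z).
exact: onto_image_closed.
Qed.

End ImageOfProperMap.

(** * Transport of efficiency to the source, and conclusion *)

Lemma homeomorphism_efficient {Y Z : topologicalType} {h : Y -> Z} {A : set Z} :
  hausdorff_space Z -> homeomorphism h -> efficient A -> efficient (h @^-1` A).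
Proof.
move=> hausZ [ch [g [hK gK cg]]] [cA [[a Aa] conA] unbA].
have -> : h @^-1` A = g @` A.
  rewrite eqEsubset; split=> [y Ay|_ [z Az <-]]; last by rewrite /preimage/= gK.
  by exists (h y).
have ctsA : {within A, continuous g} by exact: continuous_subspaceT.
split; first exact: continuous_compact.
- by split; [exists (g a); exists a|exact: connected_continuous_connected].
- move=> _ [y nAy ->]; set C := connected_component _ y => bC.
  have nAhy : (~` A) (h y) by move=> Ay; apply: nAy; exists (h y).
  (* The proper map [g] carries the component of [h y] into [C]; were [C] bounded, that component
     would be bounded too. *)
  apply: (connected_component_unbounded unbA nAhy).
  apply: (bounded_in_proper_preimage (i := g)) bC => //.
    split=> // K cK; have -> : g @^-1` K = h @` K.
      rewrite eqEsubset; split=> [z Kz|_ [x Kx <-]]; last by rewrite /preimage/= hK.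
      by exists (g z).
    by apply: continuous_compact => //; exact: continuous_subspaceT.
  rewrite /C -{2}(hK y); apply: component_image_sub => // z nAz [x Ax xz].
  by apply: nAz; rewrite -(gK z) -xz gK.
Qed.

Theorem theorem4p5 (Y X : topologicalType) (f : Y -> X)
    (hY : generalized_continuum Y) (hX : generalized_continuum X)
    (hf : proper_map f) :
  (exists K : nat -> set X, f_efficient f K) /\
  (injective f ->
    embedding f /\
    forall K : nat -> set X, f_efficient f K ->
      efficient_compact_exhaustion (fun i => f @^-1` K i)).
Proof.
have hZ := image_generalized_continuum f hY hX hf.
split=> [|injf].
  have [K effK effZK] :=
    exists_biefficient_exhaustion hZ hX (set_val_proper f hf) val_inj.
  by exists K; split=> //; apply: compact_exhaustion_preimage => //; case: effK.
have embf := proper_injective_embedding f hX hf injf.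
split=> // K [_ [_ effZK] exhK]; split=> // n.
(* [f] is convertible to [set_val] after [onto_image f], so the preimage of the trace of [K n] is
   the preimage of [K n] under [f]. *)
by have [hausZ _ _ _ _] := hZ; exact: homeomorphism_efficient hausZ embf (effZK n).
Qed.
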